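(* Let $q=p^h$ with $p$ prime and $h\ge 1$, and let $C$ be a linear $(n,k,q)$-MDS code. If $h>1$, let $t<h$ be the largest proper divisor of $h$. Put \[ \beta=\begin{cases} \frac12(q-3)+k & \text{if } q \text{ is prime (i.e. } h=1),\\ q-p^{h-t}+k-1 & \text{otherwise.}\end{cases}\] If $n>\beta$, then every (arbitrary, not necessarily linear) $(n+1,k,q)$-MDS code $C'$ extending $C$ is an LE code.
   Context: An $(n,k,q)$-MDS code over an alphabet $\mathcal A$ of size $q$ is a set of $q^k$ $n$-tuples (words) over $\mathcal A$ such that no two distinct words agree in $k$ or more coordinate positions. It is linear if $\mathcal A=GF(q)$ and the code is a $k$-dimensional subspace of $GF(q)^n$. An $(m,k,q)$-MDS code $C'$ with $m>n$ (over the same alphabet) is an extension of (extends) the $(n,k,q)$-MDS code $C$ if deleting some fixed set of $m-n$ coordinate positions from every word of $C'$ yields $C$. Two codes of length $n$ over $\mathcal A$, viewed as matrices whose rows are the words, are equivalent if one is obtained from the other by a sequence of operations of the types: permuting rows; permuting columns; applying a permutation of the alphabet entrywise to a single column. A code is an LE code if it is equivalent to a linear code. *)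

(* Defs.v *)
From mathcomp Require Import all_boot all_order all_fingroup all_algebra.
From Stdlib Require Import Relation_Operators.

Set Implicit Arguments.
Unset Strict Implicit.
Unset Printing Implicit Defensive.

(* A code of length n over the alphabet A is the set of its words, each word
   being a row of the associated matrix.  Working with a set rather than a
   matrix makes the order of the words immaterial. *)

Definition agreement (A : finType) (n : nat) (x y : 'rV[A]_n) : {set 'I_n} :=
  [set i | x ord0 i == y ord0 i].

Definition MDS_code (A : finType) (n k : nat) (C : {set 'rV[A]_n}) : Prop :=
  #|C| = #|A| ^ k /\
  (forall x y, x \in C -> y \in C -> x != y -> #|agreement x y| < k).

Definition linear_code (F : finFieldType) (n k : nat) (C : {set 'rV[F]_n}) :
    Prop :=
  exists U : {vspace 'rV[F]_n}, \dim U = k /\ C = [set x | x \in U].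

(* The increasing map f enumerates the n positions that are kept, so its
   choice amounts to that of the set of m - n deleted positions. *)
Definition extends (A : finType) (m n : nat)
    (C' : {set 'rV[A]_m}) (C : {set 'rV[A]_n}) : Prop :=
  n < m /\
  exists f : 'I_n -> 'I_m,
    (forall i j : 'I_n, i < j -> f i < f j) /\
    [set colsub f x | x in C'] = C.

Definition relabel (A : finType) (n : nat) (j : 'I_n) (s : {perm A})
    (x : 'rV[A]_n) : 'rV[A]_n :=
  \row_i (if i == j then s (x ord0 i) else x ord0 i).

(* Permuting rows does not change the set of words, so it needs no
   constructor. *)
Inductive code_step (A : finType) (n : nat) (C : {set 'rV[A]_n}) :
    {set 'rV[A]_n} -> Prop :=
  | step_columns (s : 'S_n) : code_step C [set col_perm s x | x in C]
  | step_alphabet (j : 'I_n) (s : {perm A}) :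
      code_step C [set relabel j s x | x in C].

Definition equivalent (A : finType) (n : nat) :
    {set 'rV[A]_n} -> {set 'rV[A]_n} -> Prop :=
  clos_refl_trans _ (@code_step A n).

Definition LE_code (F : finFieldType) (n : nat) (C : {set 'rV[F]_n}) : Prop :=
  exists (k : nat) (D : {set 'rV[F]_n}), linear_code k D /\ equivalent C D.

Definition largest_proper_divisor (h : nat) : nat :=
  \max_(d < h | d %| h) d.

(* beta lives in rat because (q - 3) / 2 need not be a natural number: it is
   -1/2 for q = 2. *)
Definition beta (p h k : nat) : rat :=
  let q := p ^ h in
  let t := largest_proper_divisor h in
  (if h == 1%N then (q%:R - 3%:R) / 2%:R + k%:R
   else q%:R - (p ^ (h - t))%:R + k%:R - 1)%R.

(* Main.v *)
Require Import Defs.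
From mathcomp Require Import all_boot all_order all_fingroup all_algebra.
From mathcomp Require Import cyclic finfield zify ring lra.

Set Implicit Arguments.
Unset Strict Implicit.
Unset Printing Implicit Defensive.

(** Let q = p ^ h.  In coordinates given by k positions of C, the code C is the
set of words x *m E with x : 'rV_k, and C' adds to each such word one more
symbol phi x.  As C' is MDS, phi x != phi y whenever x != y and (x - y) *m E has
k - 1 zeros.  It is enough to find a linear form L and a permutation s of F such
that s (phi x) = L x for all x, since relabelling the new column by s then makes
C' linear.

Consider first the restriction of phi to a plane v + <e_i, e_j>.  Each position
at which e_i *m E does not vanish gives a direction along which phi is
injective, and these directions are distinct, so there are at least
n + 1 - k of them; another one is e_i.  A level set is therefore the graph of a
function f : F -> F whose chords have N <= q - (n + 1 - k) slopes.  The bound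
on n makes N at most q / 2 and less than q / p ^ e for every divisor 0 < e < h
of h.  Such an f is affine (affine_of_few_slopes).  Disjoint level sets are
then parallel lines, so that phi (v + x e_i + y e_j) = phi (v + (x + lam y) e_i)
for some lam that depends on v, i and j.  Comparing the two ways of moving
z e_l + y e_j onto the e_i axis gives
lam_ij (v + z e_l) = lam_il (v) lam_lj (v), so lam does not depend on v
(shear_everywhere), and phi factors through a linear form (factor_through_form).

The theorem on slopes is a form of a result of Redei, Blokhuis, Ball, Brouwer,
Storme and Szonyi, and rests on the polynomial
R (X, Y) = prod_x (X - (x Y - f x)).
If y is not a slope then R (X, y) = X ^ q - X; as the coefficient of X ^ i has
degree at most q - i in Y, it vanishes for N < i < q.  If y is a slope,
R (X, y) = X ^ q + g with deg g <= N.  All roots of R (X, y) lie in F and its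
derivative is g', so it divides (X ^ q - X) g', hence also (X + g) g', whose
degree is less than q; so (X + g) g' = 0, and g != - X because y is a slope,
whence g' = 0 (deriv_redei_at).
Consequently dR/dX is a polynomial c (Y) alone (deriv_redei_const).  Putting
X = u Y - f u shows that c is, up to a constant, the product of the Y - m over
all slopes m of chords through (u, f u), whatever u is (slope_polyE).  Hence
all the lines of slope y that meet the graph meet it in the same number
line_size y of points (card_line); this number divides q, so it is a power of p,
and it is greater than 1 exactly when y is a slope.

Let r = p ^ e be the least line_size of a slope; move a point of a line that
attains it to the origin and its slope to 0.  If r = q the graph is a line.
Otherwise all line sizes of slopes are multiples of r, so R has no term in X ^ i
for 1 < i < r, and the coefficient of Y ^ r in R (z Y, Y) shows that the r points
of the line are the roots of a polynomial K X ^ r + b X (line_polyE).  The r - 1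
nonzero roots have the same power of exponent r - 1, so their quotients are r - 1
roots of unity of order dividing r - 1; thus r - 1 divides q - 1 and e divides h
(min_line_dvdn).  Finally R (X, 0) = S ^ r where S has q / r simple
roots in F, so S divides R (X, 0) - (X ^ q - X), of degree at most N, and
q / r <= N (min_line_card), a contradiction. *)

(** * Polynomials over a finite field *)

Lemma size_index_enum (T : finType) : size (index_enum T) = #|T|.
Proof.
rewrite -(card_uniqP (index_enum_uniq T)).
by apply: eq_card => x; rewrite mem_index_enum.
Qed.

Section Polynomials.
Import GRing.Theory.
Local Open Scope ring_scope.

Lemma vanishing_poly_eq0 (F : finFieldType) (p : {poly F}) (A : {set F}) :
  (size p <= #|A|)%N -> {in A, forall a, p.[a] = 0} -> p = 0.
Proof.
move=> sz_p pA; apply/eqP; apply: contraLR sz_p => nz_p.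
rewrite -ltnNge cardE; apply: max_poly_roots nz_p _ (enum_uniq _).
by apply/allP=> a; rewrite mem_enum => /pA pa; apply/rootP.
Qed.

Lemma finField_vanishing_poly_eq0 (F : finFieldType) (p : {poly F}) :
  (size p <= #|F|)%N -> (forall a, p.[a] = 0) -> p = 0.
Proof.
by move=> sz_p p0; apply: (@vanishing_poly_eq0 _ _ setT) => //; rewrite cardsT.
Qed.

(** A root of multiplicity m of a product of linear factors is a root of
multiplicity at least m - 1 of the derivative; a polynomial Z that vanishes at
all the roots makes up for the difference. *)
Lemma prod_XsubC_dvdp_deriv (R : fieldType) (I : Type) (s : seq I)
    (c : I -> R) (Z : {poly R}) :
  (forall i, 'X - (c i)%:P %| Z) ->
  \prod_(i <- s) ('X - (c i)%:P) %| Z * (\prod_(i <- s) ('X - (c i)%:P))^`().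
Proof.
move=> dvdZ; elim: s => [|i s IHs]; first by rewrite big_nil dvd1p.
rewrite big_cons derivM derivXsubC mul1r mulrDr dvdp_add //.
  by rewrite dvdp_mul.
by rewrite mulrCA dvdp_mul.
Qed.

Lemma horner_deriv_prod_root (R : comNzRingType) (I : finType) (c : I -> R)
    (u : I) :
  (\prod_i ('X - (c i)%:P))^`().[c u] = \prod_(i | i != u) (c u - c i).
Proof.
rewrite (bigD1 u) //= derivM derivXsubC mul1r hornerD hornerM hornerXsubC.
rewrite subrr mul0r addr0 horner_prod.
by apply: eq_bigr => i _; rewrite hornerXsubC.
Qed.

(** When the c j have degree at most 1, the coefficient of 'X^i in the product
has degree at most size s - i.  The truncated subtraction says as well that this
coefficient is 0 if size s < i. *)
Lemma size_coef_prod_XsubC (R : idomainType) (I : Type) (s : seq I)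
    (c : I -> {poly R}) (i : nat) :
  (forall j, size (c j) <= 2)%N ->
  (size ((\prod_(j <- s) ('X - (c j)%:P))`_i)%R <= (size s).+1 - i)%N.
Proof.
move=> sz_c; elim: s i => [|j s IHs] i.
  rewrite big_nil coef1; case: i => [|i]; rewrite ?size_poly1 //=.
  by rewrite size_poly0.
rewrite big_cons mulrBl coefB coefXM coefCM (leq_trans (size_polyD _ _)) //.
rewrite geq_max size_polyN; apply/andP; split.
  case: i => [|i] /=; first by rewrite size_poly0.
  by rewrite subSS.
have := IHs i; set d := _`_i => sz_d.
have [-> | nz_d] := eqVneq d 0; first by rewrite mulr0 size_poly0.
apply: leq_trans (size_polyMleq _ _) _.
have := sz_c j; have : (0 < size d)%N by rewrite size_poly_gt0.
move=> /=; move: sz_d; move: (size d) (size (c j)) (size s) => x y z.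
by lia.
Qed.

Lemma mup_prod (R : fieldType) (I : finType) (P : pred I) (G : I -> {poly R}) y :
  (forall i, P i -> G i != 0) ->
  mup y (\prod_(i | P i) G i)%R = (\sum_(i | P i) mup y (G i))%N.
Proof.
move=> nzG.
suff: (\prod_(i | P i) G i != 0) &&
  (mup y (\prod_(i | P i) G i)%R == (\sum_(i | P i) mup y (G i))%N).
  by case/andP=> _ /eqP.
apply: (big_rec2 (fun a b => (a != 0) && (mup y a == b))).
  by rewrite oner_neq0 mupNroot ?eqxx // rootC oner_neq0.
move=> i a _ Pi /andP[nza /eqP <-]; rewrite mulf_neq0 ?nzG //=.
by rewrite mupM ?nzG.
Qed.

Lemma mup_linear (R : fieldType) (a b y : R) :
  a != 0 -> mup y (a *: 'X - b%:P) = (a * y == b).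
Proof.
move=> nz_a; have -> : a *: 'X - b%:P = a%:P * ('X - (b / a)%:P).
  by rewrite mulrBr mul_polyC -polyCM mulrC divfK.
rewrite mupMr ?rootC // -['X - _]expr1 mup_XsubCX.
have -> : (b / a == y) = (a * y == b).
  by rewrite -(inj_eq (mulIf nz_a)) divfK // eq_sym mulrC.
by case: eqP.
Qed.

Lemma natr_card_eq0 (F : finFieldType) : #|F|%:R = 0 :> F.
Proof.
by have := expg_cardG (in_setT (1 : F)); rewrite FinRing.zmodXgE cardsT.
Qed.

End Polynomials.

(** * Slopes of the chords of a function *)

Section Directions.
Import GRing.Theory.
Local Open Scope ring_scope.

Variable F : finFieldType.
Implicit Type f : F -> F.

(** The line of slope y through the point (x, f x) of the graph of f consists
of the points (x', f x') with the same intercept; intercepts are counted with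
the sign opposite to the usual one. *)
Definition intercept f (y x : F) : F := y * x - f x.

(** The finite directions determined by the graph of f: y is the slope of a
chord exactly when two points of the graph have the same intercept. *)
Definition slopes f : {set F} := [set y | ~~ injectiveb (intercept f y)].

(** The Redei polynomial of the graph of f, as a polynomial in the intercept
whose coefficients are polynomials in the slope. *)
Definition redei f : {poly {poly F}} :=
  \prod_x ('X - (x *: 'X - (f x)%:P)%:P).

(** The specialisation of the Redei polynomial at the slope y. *)
Definition redei_at f (y : F) : {poly F} :=
  \prod_x ('X - (intercept f y x)%:P).

Lemma horner_linear (a b y : F) : (a *: 'X - b%:P).[y] = a * y - b.
Proof. by rewrite !hornerE. Qed.

Lemma map_redei f y : map_poly (horner_eval y) (redei f) = redei_at f y.
Proof.
rewrite rmorph_prod; apply: eq_bigr => x _ /=.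
by rewrite map_polyXsubC /= horner_evalE horner_linear mulrC.
Qed.

Lemma horner_coef_redei f i y : ((redei f)`_i).[y] = (redei_at f y)`_i.
Proof. by rewrite -map_redei coef_map. Qed.

Lemma size_coef_redei f i : (size ((redei f)`_i)%R <= #|F|.+1 - i)%N.
Proof.
have := @size_coef_prod_XsubC F F (index_enum F)
  (fun x => x *: 'X - (f x)%:P) i.
rewrite size_index_enum; apply=> x.
rewrite (leq_trans (size_polyD _ _)) // geq_max size_polyN.
rewrite (leq_trans (size_scale_leq _ _)) ?size_polyX //.
by rewrite (leq_trans (size_polyC_leq1 _)).
Qed.

Lemma size_redei_at f y : size (redei_at f y) = #|F|.+1.
Proof. by rewrite size_prod_XsubC size_index_enum. Qed.

Lemma redei_at_monic f y : redei_at f y \is monic.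
Proof. exact: monic_prod_XsubC. Qed.

Lemma notin_slopes f y : y \notin slopes f -> injective (intercept f y).
Proof. by rewrite inE negbK => /injectiveP. Qed.

Lemma redei_at_notin_slopes f y :
  y \notin slopes f -> redei_at f y = 'X^#|F| - 'X.
Proof.
move/notin_slopes=> inj_y.
by rewrite finField_genPoly (reindex_inj inj_y).
Qed.

Section FewSlopes.

Variable f : F -> F.
Local Notation q := #|F|.
Local Notation N := #|slopes f|.
Hypothesis N_gt0 : (0 < N)%N.
Hypothesis N_small : (2 * N <= q)%N.

(** If N < i < q, the coefficient of X ^ i in the Redei polynomial vanishes at
the q - N elements that are not slopes, and these exceed its degree. *)
Lemma size_redei_tail y : (size (redei_at f y - 'X^q)%R <= N.+1)%N.
Proof.
apply/leq_sizeP=> i lt_N_i; rewrite coefB coefXn.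
case: (ltngtP i q) => [lt_i_q | lt_q_i | ->].
- rewrite subr0 -horner_coef_redei.
  rewrite (_ : (redei f)`_i = 0) ?horner0 //.
  apply: (@vanishing_poly_eq0 _ _ (~: slopes f)) => [|a].
    apply: leq_trans (size_coef_redei f i) _; rewrite (cardsCs (~: _)) setCK.
    by rewrite -[leqRHS]subSS; apply: leq_sub2l.
  rewrite inE horner_coef_redei => /redei_at_notin_slopes ->.
  rewrite coefB coefXn coefX ltn_eqF // (_ : (i == 1)%N = false) ?subrr //; lia.
- by rewrite subr0 nth_default // size_redei_at.
- rewrite -[q in _`_q]/(q.+1.-1) -(size_redei_at f y) -lead_coefE.
  by rewrite (monicP (redei_at_monic f y)) subrr.
Qed.

(** Equivalently, a line whose slope is that of a chord meets the graph in a
number of points divisible by the characteristic. *)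
Lemma deriv_redei_at y : y \in slopes f -> (redei_at f y)^`() = 0.
Proof.
move=> y_slope; set s := redei_at f y; set g := s - 'X^q.
have size_g : (size g <= N.+1)%N by apply: size_redei_tail.
have s'E : s^`() = g^`().
  by rewrite derivB derivXn -scaler_nat natr_card_eq0 scale0r subr0.
have s_dvd : s %| (g + 'X) * g^`().
  have : s %| ('X^q - 'X) * s^`().
    apply: prod_XsubC_dvdp_deriv => x.
    by rewrite dvdp_XsubCl /root !hornerE expf_card subrr.
  have -> : 'X^q - 'X = s - (g + 'X) by rewrite /g; ring.
  by rewrite -s'E mulrBl dvdp_subr; [apply | apply: dvdp_mulr].
rewrite s'E; apply/eqP; apply: contraLR y_slope => nz_g'.
have : (g + 'X) * g^`() == 0.
  apply: contraLR s_dvd => nz; apply/negP => /(dvdp_leq nz).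
  rewrite size_redei_at size_mul //; last first.
    by apply: contra_neq nz => ->; rewrite mul0r.
  have := lt_size_deriv (_ : g != 0).
  have : (size (g + 'X)%R <= N.+1)%N.
    by rewrite (leq_trans (size_polyD _ _)) // geq_max size_g size_polyX ltnS.
  have nz_g : g != 0 by apply: contra_neq nz_g' => ->; rewrite deriv0.
  move=> sz_gX /(_ nz_g) sz_g' lt_q.
  have arith a b c m n : (a <= n.+1 -> b < c -> c <= n.+1 -> 2 * n <= m ->
    m < (a + b).-1 -> False)%N by lia.
  exact: arith sz_gX sz_g' size_g N_small lt_q.
rewrite mulf_eq0 (negPf nz_g') orbF addr_eq0 => /eqP g_def.
(* Now g = - 'X, so every element of F is an intercept: y is not a slope. *)
have sE : s = 'X^q - 'X by rewrite -[s](subrK 'X^q) -/g g_def addrC.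
rewrite inE negbK; apply/(@card_uniqP _ (codom _)); rewrite size_codom.
apply: eq_card => a; rewrite [RHS]inE.
have : root s a by rewrite sE /root !hornerE expf_card subrr.
rewrite /s /redei_at -(big_map _ predT (fun c => 'X - c%:P)) root_prod_XsubC.
by case/mapP=> x _ ->; rewrite codom_f.
Qed.

(** The partial derivative of the Redei polynomial with respect to the
intercept depends on the slope only. *)
Lemma deriv_redei_const : (redei f)^`() = (((redei f)^`())`_0)%:P.
Proof.
apply/size1_polyC/leq_sizeP=> i i_gt0.
have [lt_q_i | lt_i_q] := leqP q i.
  rewrite coef_deriv [_`_i.+1]nth_default ?mul0rn //.
  by rewrite /redei size_prod_XsubC size_index_enum.
apply: finField_vanishing_poly_eq0 => [|a].
  rewrite coef_deriv -scaler_nat (leq_trans (size_scale_leq _ _)) //.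
  by apply: leq_trans (size_coef_redei f i.+1) _; rewrite subSS leq_subr.
rewrite -horner_evalE -coef_map -deriv_map map_redei.
have [a_slope | a_nslope] := boolP (a \in slopes f).
  by rewrite deriv_redei_at // coef0.
rewrite redei_at_notin_slopes // derivB derivXn derivX -scaler_nat.
by rewrite natr_card_eq0 scale0r sub0r coefN coef1 gtn_eqF ?oppr0.
Qed.

(** The polynomial in the slope to which the derivative of the Redei polynomial
reduces. *)
Definition slope_poly : {poly F} := ((redei f)^`())`_0.

(** The value of slope_poly given by the chords through (u, f u); as
slope_poly does not depend on u, neither does the multiset of the slopes of
these chords. *)
Lemma slope_polyE u :
  slope_poly = \prod_(x | x != u) ((u - x) *: 'X - (f u - f x)%:P).
Proof.
have := horner_deriv_prod_root (fun x => x *: 'X - (f x)%:P) u.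
rewrite -/(redei f) deriv_redei_const hornerC -/slope_poly => ->.
apply: eq_bigr => x _; rewrite scalerBl rmorphB /=; ring.
Qed.

Lemma mup_slope_poly y u :
  (mup y slope_poly).+1 = #|[set x | intercept f y x == intercept f y u]|.
Proof.
rewrite (cardsD1 u) inE eqxx add1n; congr _.+1; rewrite (slope_polyE u).
have nz_uB x : x != u -> u - x != 0 by rewrite subr_eq0 eq_sym.
rewrite mup_prod => [|x x_u]; last first.
  apply: contra_neq (nz_uB x x_u) => /(congr1 (coefp 1)) /=.
  by rewrite coefB coefZ coefX coefC coef0 mulr1 subr0.
rewrite -sum1_card [RHS]big_mkcond [LHS]big_mkcond /=.
apply: eq_bigr => x _; rewrite !inE; have [//|x_u /=] := eqVneq x u.
rewrite mup_linear ?nz_uB // /intercept.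
have -> : (y * x - f x == y * u - f u) = ((u - x) * y == f u - f x).
  by rewrite -subr_eq0 -[RHS]subr_eq0 -oppr_eq0; congr (_ == _); ring.
by case: eqP.
Qed.

(** The number of points of the graph on a line of slope y that meets it; by
card_line the choice of the line through (0, f 0) does not matter. *)
Definition line_size y := #|[set x | intercept f y x == intercept f y 0]|.

Lemma card_line y u :
  #|[set x | intercept f y x == intercept f y u]| = line_size y.
Proof. by rewrite -mup_slope_poly /line_size -mup_slope_poly. Qed.

(** The intercepts of the lines of slope y that meet the graph. *)
Definition intercepts y : {set F} := intercept f y @: setT.

(* The trivial premise is the filter of the products that partition_big splits. *)
Lemma mem_intercepts y x : true -> intercept f y x \in intercepts y.
Proof. by move=> _; rewrite imset_f. Qed.

Lemma redei_at_exp y :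
  redei_at f y = (\prod_(a in intercepts y) ('X - a%:P)) ^+ line_size y.
Proof.
rewrite /redei_at (partition_big _ _ (mem_intercepts y)) /=.
rewrite -prodrXl; apply: eq_bigr => _ /imsetP[u _ ->].
rewrite -(card_line y u) -prodr_const; apply: eq_big => [x | x /eqP -> //].
by rewrite !inE.
Qed.

Lemma card_intercepts y : (#|intercepts y| * line_size y)%N = #|F|.
Proof.
rewrite -sum_nat_const -[RHS]sum1_card (partition_big _ _ (mem_intercepts y)) /=.
apply: eq_bigr => _ /imsetP[u _ ->]; rewrite -(card_line y u) -sum1_card.
by apply: eq_bigl => x; rewrite !inE.
Qed.

Lemma line_size_slope y : (1 < line_size y)%N = (y \in slopes f).
Proof.
apply/idP/idP => [|y_slope].
  apply: contraTT => /notin_slopes inj_y; rewrite -leqNgt.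
  rewrite -(cards1 (0 : F)) subset_leq_card //; apply/subsetP => x.
  by rewrite !inE (inj_eq inj_y).
rewrite ltnNge; apply/negP => le1.
move: y_slope; rewrite inE => /injectiveP[] a b eq_ab.
have /card_le1_eqP : (#|[set x | intercept f y x == intercept f y b]| <= 1)%N.
  by rewrite card_line.
by apply; rewrite !inE ?eq_ab.
Qed.

End FewSlopes.

End Directions.

(** * Lines with the fewest points *)

(** The converse of dvdn_pred_predX. *)
Lemma dvdn_predn_exp2 p d h : 1 < p -> (p ^ d).-1 %| (p ^ h).-1 -> d %| h.
Proof.
move=> p_gt1; have pX_gt0 n : 0 < p ^ n by rewrite expn_gt0 (ltnW p_gt1).
rewrite {1}(divn_eq h d) expnD mulnC.
have -> : (p ^ (h %% d) * p ^ (h %/ d * d)).-1 =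
    p ^ (h %% d) * (p ^ (h %/ d * d)).-1 + (p ^ (h %% d)).-1.
  have := pX_gt0 (h %% d); have := pX_gt0 (h %/ d * d).
  by case: (p ^ (_ * _)) => // a; case: (p ^ _) => // b _ _ /=; lia.
rewrite dvdn_addr; last by apply: dvdn_mull; rewrite mulnC expnM dvdn_pred_predX.
have [-> | d_gt0] := posnP d.
  rewrite modn0 dvd0n; have := pX_gt0 h; case: (h) => // n; rewrite expnS.
  by have := pX_gt0 n; nia.
case: (posnP (h %% d)) => [/eqP // | r_gt0].
have lt_rd : p ^ (h %% d) < p ^ d by rewrite ltn_exp2l // ltn_pmod.
move/dvdn_leq; have : 1 < p ^ (h %% d) by rewrite -(expn0 p) ltn_exp2l.
by have := pX_gt0 d; lia.
Qed.

Section FewestPoints.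
Import GRing.Theory.
Local Open Scope ring_scope.

(** The elements of A make up a subgroup of order m of the units of F. *)
Lemma unity_roots_dvdn (F : finFieldType) (m : nat) (A : {set F}) :
  (0 < m <= #|A|)%N -> {in A, forall a, a ^+ m = 1} -> (m %| #|F|.-1)%N.
Proof.
case/andP=> m_gt0 le_mA Am1; have F_gt1 := finNzRing_gt1 F.
have q1_gt0 : (0 < #|F|.-1)%N by rewrite -ltnS prednK // ltnW.
set g := gcdn m #|F|.-1.
have Ag : all g.-unity_root (enum A).
  apply/allP=> a; rewrite mem_enum => /Am1 am1; apply/unity_rootP.
  have nz_a : a != 0.
    by apply: contra_eq_neq am1 => ->; rewrite expr0n gtn_eqF // eq_sym oner_eq0.
  have aq1 : a ^+ #|F|.-1 = 1.
    by apply: (mulfI nz_a); rewrite -exprS prednK ?expf_card ?mulr1 // ltnW.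
  have [u v def_g _] := egcdnP #|F|.-1 m_gt0.
  have := congr1 (fun n => a ^+ n) def_g; rewrite exprD mulnC exprM am1 expr1n.
  by rewrite mulnC exprM aq1 expr1n mul1r.
have := max_unity_roots (_ : 0 < g)%N Ag (enum_uniq _).
rewrite -cardE gcdn_gt0 m_gt0 => /(_ isT) le_Ag.
have -> : m = g; last exact: dvdn_gcdr.
apply/eqP; rewrite eqn_leq (leq_trans le_mA le_Ag).
by rewrite dvdn_leq // dvdn_gcdl.
Qed.

(** In characteristic p, a power of exponent p ^ e is a polynomial in
'X^(p ^ e). *)
Lemma coef_exp_pchar (R : idomainType) (p e : nat) (P : {poly R}) (i : nat) :
  p \in [pchar R] -> (0 < i < p ^ e)%N -> (P ^+ (p ^ e))`_i = 0.
Proof.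
move=> pcharR /andP[i_gt0 lt_i]; elim/poly_ind: P => [|P c _].
  by rewrite expr0n gtn_eqF ?coef0 // (ltn_trans i_gt0 lt_i).
rewrite exprDn_pchar; last first.
  by rewrite pnatX pnatE ?(pcharf_prime pcharR) // pchar_poly pcharR.
rewrite coefD exprMn coefMXn lt_i add0r -rmorphXn /= coefC.
by case: (i) i_gt0.
Qed.

(** A line of slope 0 through the origin that meets the graph in r points, where
1 < r < q and r is the least line_size of a slope. *)
Section MinimalLine.

Variables (F : finFieldType) (p e : nat) (f : F -> F).
Local Notation q := #|F|.
Local Notation N := #|slopes f|.
Local Notation r := (p ^ e)%N.
Hypothesis pcharF : p \in [pchar F].
Hypothesis N_gt0 : (0 < N)%N.
Hypothesis N_small : (2 * N <= q)%N.
Hypothesis f0 : f 0 = 0.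
Hypothesis line0 : line_size f 0 = r.
Hypothesis r_gt1 : (1 < r)%N.
Hypothesis r_lt_q : (r < q)%N.
Hypothesis r_dvd : {in slopes f, forall y, r %| line_size f y}%N.

Lemma coef_redei_eq0 i : (1 < i < r)%N -> (redei f)`_i = 0.
Proof.
case/andP=> i_gt1 lt_i_r; apply: finField_vanishing_poly_eq0 => [|y].
  by apply: leq_trans (size_coef_redei f i) _; rewrite leq_subLR; move: i_gt1; lia.
rewrite horner_coef_redei; have [y_slope | y_nslope] := boolP (y \in slopes f).
  rewrite redei_at_exp //; case/dvdnP: (r_dvd y_slope) => m ->.
  by rewrite exprM coef_exp_pchar // lt_i_r ltnW.
rewrite redei_at_notin_slopes // coefB coefXn coefX.
by rewrite ltn_eqF ?(ltn_trans lt_i_r) // gtn_eqF // subrr.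
Qed.

(** The abscissas of the points of the graph on the line of slope 0 through the
origin, a line with the fewest points. *)
Definition root_line : {set F} := [set x | f x == 0].

Lemma card_root_line : #|root_line| = r.
Proof.
rewrite -line0; apply: eq_card => x; rewrite !inE /intercept f0 !mul0r !sub0r.
by rewrite eqr_opp.
Qed.

(** The part of degree r of the Redei polynomial, dehomogenised: its value at z
is the coefficient of Y ^ r in R (z Y, Y). *)
Definition line_poly : {poly F} := \poly_(i < r.+1) ((redei f)`_i)`_(r - i).

Lemma horner_line_poly z : line_poly.[z] = ((redei f).[z *: 'X])`_r.
Proof.
have le_rq : (r.+1 <= q.+1)%N by rewrite ltnW.
rewrite horner_poly horner_coef coef_sum size_prod_XsubC size_index_enum.
rewrite (big_ord_widen _ (fun i => ((redei f)`_i)`_(r - i) * z ^+ i) le_rq).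
rewrite big_mkcond /=; apply: eq_bigr => i _.
rewrite exprZn -scalerAr coefZ coefMXn ltnS ltnNge.
by case: leqP; rewrite ?mulr0 // mulrC.
Qed.

(** Among the factors z Y - x Y + f x of R (z Y, Y), those with x on the line
are the multiples of Y. *)
Lemma redei_local z :
  ((redei f).[z *: 'X])`_r =
  (\prod_(x in root_line) (z - x)) * \prod_(x in ~: root_line) f x.
Proof.
rewrite horner_prod (bigID (mem root_line)) /=.
rewrite (eq_bigr (fun x => (z - x)%:P * 'X)) => [|x]; last first.
  by rewrite inE hornerXsubC => /eqP ->; rewrite subr0 -scalerBl mul_polyC.
rewrite big_split prodr_const /= card_root_line -rmorph_prod /= -mulrA.
rewrite coefCM coefXnM ltnn subnn; congr (_ * _).
rewrite -horner_coef0 horner_prod; apply: eq_big => [x|x _]; first by rewrite !inE.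
by rewrite hornerXsubC !hornerE; ring.
Qed.

Lemma line_polyE : line_poly =
  (\prod_(x in ~: root_line) f x) *: \prod_(x in root_line) ('X - x%:P).
Proof.
apply/eqP; rewrite -subr_eq0; apply/eqP; apply: finField_vanishing_poly_eq0.
  rewrite (leq_trans (size_polyD _ _)) // geq_max size_polyN.
  rewrite (leq_trans (size_poly _ _)) //= (leq_trans (size_scale_leq _ _)) //.
  by rewrite -big_enum size_prod_XsubC -cardE card_root_line.
move=> z; rewrite hornerD hornerN hornerZ horner_line_poly redei_local.
rewrite horner_prod mulrC; apply/eqP; rewrite subr_eq0; apply/eqP; congr (_ * _).
by apply: eq_bigr => x _; rewrite hornerXsubC.
Qed.

Lemma min_line_dvdn : (r.-1 %| q.-1)%N.
Proof.
set K := \prod_(x in ~: root_line) f x.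
have nz_K : K != 0 by apply/prodf_neq0 => x; rewrite !inE.
have r_gt0 : (0 < r)%N by rewrite ltnW.
have zero_line : 0 \in root_line by rewrite inE f0.
have line_root x : x \in root_line -> line_poly.[x] = 0.
  move=> x_line; rewrite line_polyE -/K hornerZ horner_prod (bigD1 x) //=.
  by rewrite hornerXsubC subrr mul0r mulr0.
have lead : line_poly`_r = K.
  rewrite line_polyE coefZ -[RHS]mulr1; congr (_ * _).
  have /monicP := monic_prod_XsubC (enum root_line) predT id.
  by rewrite lead_coefE size_prod_XsubC -cardE card_root_line big_enum.
have [b line_poly_sparse] : exists b, line_poly = b *: 'X + K *: 'X^r.
  exists line_poly`_1; apply/polyP=> i; rewrite coefD !coefZ coefX coefXn.
  have [-> | i_r] := eqVneq i r.
    by rewrite lead gtn_eqF // mulr0 mulr1 add0r.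
  have [-> | i_1] := eqVneq i 1%N; first by rewrite mulr1 mulr0 addr0.
  rewrite !mulr0 addr0; case: (posnP i) => [-> | i_gt0].
    by rewrite -horner_coef0 line_root.
  rewrite coef_poly; case: ltnP => // le_i_r; rewrite coef_redei_eq0 ?coef0 //.
  by move/eqP: i_r; move/eqP: i_1; move: i_gt0 le_i_r; lia.
have powE x : x \in root_line :\ 0 -> K * x ^+ r.-1 = - b.
  rewrite !inE -/root_line => /andP[nz_x /eqP fx0].
  have : line_poly.[x] == 0 by rewrite line_root // inE fx0.
  rewrite line_poly_sparse !hornerE -(prednK r_gt0) exprS => /eqP eq_x.
  apply: (mulIf nz_x); apply/eqP; rewrite mulNr -addr_eq0 -eq_x.
  by apply/eqP; ring.
have card1 : #|root_line :\ 0| = r.-1.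
  by move: card_root_line; rewrite (cardsD1 0) zero_line add1n => <-.
have [x1 x1_line] : exists x1, x1 \in root_line :\ 0.
  by apply/card_gt0P; rewrite card1 -ltnS prednK.
have nz_x1 : x1 != 0 by move: x1_line; rewrite !inE => /andP[].
apply: (@unity_roots_dvdn _ _ [set x / x1 | x in root_line :\ 0]).
  rewrite card_imset ?card1; last by apply: mulIf; rewrite invr_eq0.
  by rewrite leqnn -ltnS prednK ?r_gt1.
move=> _ /imsetP[x x_line ->].
rewrite expr_div_n; apply: canLR (mulfK _) _; first by rewrite expf_neq0.
by apply: (mulfI nz_K); rewrite mul1r !powE.
Qed.

(** With S the product of the 'X - a over the intercepts a of slope 0, both
'X^q - 'X and R (X, 0) = S ^+ r are multiples of S. *)
Lemma min_line_card : (q <= N * r)%N.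
Proof.
rewrite -(card_intercepts N_gt0 N_small 0) line0 leq_mul2r; apply/orP; right.
have exp0 := redei_at_exp N_gt0 N_small 0; rewrite line0 in exp0.
set S := \prod_(a in intercepts f 0) ('X - a%:P) in exp0.
have S_dvd_Xq : S %| 'X^q - 'X.
  by rewrite finField_genPoly (bigID (mem (intercepts f 0))) dvdp_mulr.
have S_dvd : S %| redei_at f 0 - ('X^q - 'X).
  by rewrite dvdp_sub // exp0 -(prednK (ltnW r_gt1)) exprS dvdp_mulr.
have slope0 : 0 \in slopes f by rewrite -line_size_slope // line0.
have nz : redei_at f 0 - ('X^q - 'X) != 0.
  apply/eqP=> /(congr1 (@deriv F)); rewrite !derivB deriv_redei_at // deriv0.
  rewrite derivX derivXn -scaler_nat natr_card_eq0 scale0r !sub0r opprK.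
  by move/eqP; rewrite oner_eq0.
have := dvdp_leq nz S_dvd; rewrite /S -big_enum size_prod_XsubC -cardE => le_S.
rewrite -ltnS (leq_trans le_S) // opprB addrCA addrC.
rewrite (leq_trans (size_polyD _ _)) // geq_max size_redei_tail //.
by rewrite size_polyX ltnS.
Qed.

End MinimalLine.

(** A function that is not affine has more than q / 2 slopes, or at least as
many as q / p ^ e for some proper subfield of order p ^ e. *)
Theorem affine_of_few_slopes (F : finFieldType) (p h : nat) (f : F -> F) :
  prime p -> #|F| = (p ^ h)%N -> (2 * #|slopes f| <= #|F|)%N ->
  (forall e, 0 < e < h -> e %| h -> #|slopes f| < p ^ (h - e))%N ->
  exists a b, forall x, f x = a * x + b.
Proof.
move=> pr_p card_F N_small N_lt; have p_gt1 := prime_gt1 pr_p.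
have pcharF := card_finPcharP card_F pr_p.
(* The chord through the points of abscissas 0 and 1 shows that N > 0. *)
have slope01 : f 1 - f 0 \in slopes f.
  rewrite inE; apply/injectiveP => /(_ 1 0).
  rewrite /intercept mulr1 mulr0 addrAC subrr => /(_ erefl) /eqP.
  by rewrite oner_eq0.
have N_gt0 : (0 < #|slopes f|)%N by apply/card_gt0P; exists (f 1 - f 0).
case: (arg_minnP (line_size f) slope01) => y0 y0_slope y0_min.
have line_pow y : exists2 e, (e <= h)%N & line_size f y = (p ^ e)%N.
  apply/dvdn_pfactor => //; rewrite -card_F.
  by rewrite -(card_intercepts N_gt0 N_small y) dvdn_mull.
have [e le_eh line_y0] := line_pow y0.
have [eq_eh | ne_eh] := eqVneq e h.
  exists y0, (f 0) => x.
  have : x \in [set x | intercept f y0 x == intercept f y0 0].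
    rewrite (_ : [set _ | _] = setT) ?inE //; apply/eqP.
    by rewrite eqEcard subsetT cardsT card_F -eq_eh -line_y0 leqnn.
  rewrite inE /intercept mulr0 sub0r -subr_eq0 opprK => /eqP eq0.
  by apply/eqP; rewrite -subr_eq0 -oppr_eq0; apply/eqP; rewrite -[RHS]eq0; ring.
have lt_eh : (e < h)%N by rewrite ltn_neqAle ne_eh.
(* The line of slope y0 through (0, f 0) becomes the axis f2 = 0. *)
pose f2 x := f x - y0 * x - f 0.
have intercept2 y x : intercept f2 y x = intercept f (y + y0) x + f 0.
  by rewrite /intercept /f2; ring.
have slopes2 y : (y \in slopes f2) = (y + y0 \in slopes f).
  rewrite !inE; congr (~~ _); apply/injectiveP/injectiveP => inj a b eq_ab.
    by apply: inj; rewrite !intercept2 eq_ab.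
  by apply: inj; move: eq_ab; rewrite !intercept2 => /addIr.
have card2 : #|slopes f2| = #|slopes f|.
  rewrite -(card_imset _ (addIr y0)); apply: eq_card => y.
  apply/imsetP/idP => [[z z_slope ->] | y_slope]; first by rewrite -slopes2.
  by exists (y - y0); rewrite ?slopes2 subrK.
have line2 y : line_size f2 y = line_size f (y + y0).
  apply: eq_card => x; rewrite !inE !intercept2.
  by rewrite (inj_eq (addIr _)).
have e_gt0 : (0 < e)%N.
  have : y0 \in slopes f by [].
  by rewrite -(line_size_slope N_gt0 N_small) line_y0; case: (e).
have r_gt1 : (1 < p ^ e)%N by rewrite -(expn0 p) ltn_exp2l.
have r_lt_q : (p ^ e < #|F|)%N by rewrite card_F ltn_exp2l.
have f20 : f2 0 = 0 by rewrite /f2 mulr0 subr0 subrr.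
have line20 : line_size f2 0 = (p ^ e)%N by rewrite line2 add0r.
have N2_gt0 : (0 < #|slopes f2|)%N by rewrite card2.
have N2_small : (2 * #|slopes f2| <= #|F|)%N by rewrite card2.
have r_dvd : {in slopes f2, forall y, p ^ e %| line_size f2 y}%N.
  move=> y; rewrite slopes2 line2 => /y0_min; rewrite line_y0.
  by have [e' _ ->] := line_pow (y + y0); rewrite leq_exp2l // => /dvdn_exp2l.
have e_dvd : (e %| h)%N.
  apply: (@dvdn_predn_exp2 p) => //; rewrite -card_F.
  exact: (@min_line_dvdn _ _ _ f2).
have := min_line_card N2_gt0 N2_small line20 r_gt1; rewrite card2.
rewrite leqNgt card_F -(subnK le_eh) expnD ltn_pmul2r ?expn_gt0 ?(ltnW p_gt1) //.
by rewrite N_lt ?e_gt0.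
Qed.

End FewestPoints.

(** * From planes to a linear form *)

Section Gluing.
Import GRing.Theory.
Local Open Scope ring_scope.

(** On a plane, if psi is injective along the direction (1, 0) and along many
directions (m, 1), its level sets are the lines of one direction (- lam, 1).
Indeed a level set is the graph, over the second coordinate, of a function whose
slopes avoid A. *)
Lemma plane_level_sets_parallel (F : finFieldType) (p h : nat)
    (psi : F -> F -> F) (A : {set F}) :
  prime p -> #|F| = (p ^ h)%N ->
  (forall y, injective (psi^~ y)) ->
  (forall m x y t, m \in A -> t != 0 -> psi (x + m * t) (y + t) != psi x y) ->
  (2 * (#|F| - #|A|) <= #|F|)%N ->
  (forall e, 0 < e < h -> e %| h -> #|F| - #|A| < p ^ (h - e))%N ->
  exists lam, forall x y, psi x y = psi (x + lam * y) 0.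
Proof.
move=> pr_p card_F inj_psi psiA A_large A_larger.
pose f c y := invF (inj_psi y) c.
have fK c y : psi (f c y) y = c by rewrite /f (f_invF (inj_psi y)).
have slopes_f c : (#|slopes (f c)| <= #|F| - #|A|)%N.
  have <- : #|~: A| = (#|F| - #|A|)%N by rewrite -(cardsC A) addKn.
  rewrite subset_leq_card //; apply/subsetP => m.
  rewrite !inE; apply: contra => mA.
  apply/injectiveP => a b; rewrite /intercept => eq_ab.
  apply/eqP; apply: contraT => ne_ab; have ne0 : a - b != 0 by rewrite subr_eq0.
  have := psiA m (f c b) b (a - b) mA ne0.
  have -> : f c b + m * (a - b) = f c a.
    transitivity (m * a - (m * a - f c a)); last by ring.
    by rewrite eq_ab; ring.
  by rewrite addrC subrK !fK eqxx.
have f_affine c y : f c y = (f c 1 - f c 0) * y + f c 0.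
  have [||a [b fE]] := @affine_of_few_slopes F p h (f c) pr_p card_F.
  - by rewrite (leq_trans _ A_large) // leq_mul2l slopes_f orbT.
  - by move=> e he e_dvd; apply: leq_ltn_trans (A_larger e he e_dvd).
  by rewrite !fE; ring.
pose lead c := f c 1 - f c 0.
(* Graphs of affine functions with distinct slopes meet, but level sets of
distinct values are disjoint. *)
have lead_const c : lead c = lead (psi 0 0).
  set c0 := psi 0 0; apply/eqP; rewrite -subr_eq0; apply: contraT => ne0.
  have : f c ((f c0 0 - f c 0) / (lead c - lead c0)) =
         f c0 ((f c0 0 - f c 0) / (lead c - lead c0)).
    rewrite f_affine [RHS]f_affine -/(lead c) -/(lead c0); by field.
  move/(congr1 (psi^~ ((f c0 0 - f c 0) / (lead c - lead c0)))) => /=.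
  by rewrite !fK => eq_c; rewrite eq_c subrr eqxx in ne0.
exists (- lead (psi 0 0)) => x y; set c := psi x y.
have xE : x = f c y by apply: (inj_psi y); rewrite fK.
rewrite -(lead_const c) {1}xE f_affine -/(lead c).
by rewrite mulNr addrAC subrr add0r fK.
Qed.

Section FactorThroughForm.

Variables (F : fieldType) (k : nat) (phi : 'rV[F]_k -> F).
Local Notation e i := (delta_mx (0 : 'I_1) i).
Hypothesis phi_inj : forall i v, injective (fun x => phi (v + x *: e i)).
Hypothesis phi_plane : forall i j v, i != j ->
  exists lam, forall x y,
    phi (v + x *: e i + y *: e j) = phi (v + (x + lam * y) *: e i).

(** On the plane through v spanned by e i and e j, the level sets of phi are the
lines of direction e j - lam *: e i. *)
Definition shear i j v lam := forall x y,
  phi (v + x *: e i + y *: e j) = phi (v + (x + lam * y) *: e i).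

(** The displacement z *: e l + e j is moved onto the axis e i either one
summand at a time, or through e l. *)
Lemma shear_other i j l v z nu kappa mu :
  shear i l v nu -> shear l j v kappa -> shear i j (v + z *: e l) mu ->
  mu = nu * kappa.
Proof.
move=> nuP kappaP muP.
have := muP 0 1; rewrite scale0r addr0 kappaP mulr1 add0r.
have := nuP 0 (z + kappa * 1); rewrite scale0r addr0 mulr1 => ->.
rewrite -[in RHS]addrA [z *: _ + _]addrC addrA nuP => /phi_inj eq_mu.
by apply: (addIr (nu * z)); rewrite mulr1 in eq_mu; rewrite -eq_mu; ring.
Qed.

Lemma shear_translate i j l v z mu :
  i != j -> shear i j v mu -> shear i j (v + z *: e l) mu.
Proof.
move=> ij muP.
have addZ w a b i' : w + a *: e i' + b *: e i' = w + (a + b) *: e i'.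
  by rewrite scalerDl addrA.
have [-> | li] := eqVneq l i.
  by move=> x y; rewrite !addZ muP addrA.
have [-> | lj] := eqVneq l j.
  move=> x y; rewrite addrAC addZ addrAC muP (addrAC v) muP.
  by congr (phi (_ + _ *: _)); ring.
have il : i != l by rewrite eq_sym.
have [nu nuP] := phi_plane v il.
have [kappa kappaP] := phi_plane v lj.
have [mu' mu'P] := phi_plane (v + z *: e l) ij.
have -> : mu = mu'; last exact: mu'P.
rewrite (shear_other nuP kappaP mu'P).
by apply: (shear_other (z := 0) nuP kappaP); rewrite scale0r addr0.
Qed.

Lemma shear_everywhere i j v lam : i != j -> shear i j 0 lam -> shear i j v lam.
Proof.
move=> ij lamP.
suff shear_sum (s : seq 'I_k) u : shear i j u lam ->
    shear i j (u + \sum_(l <- s) v 0 l *: e l) lam.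
  by rewrite (row_sum_delta v) -[X in shear _ _ X]add0r; apply: shear_sum.
elim: s u => [|l s IHs] u uP; first by rewrite big_nil addr0.
by rewrite big_cons addrA; apply/IHs/shear_translate.
Qed.

Lemma factor_through_form (i : 'I_k) :
  exists a : 'I_k -> F, forall v, phi v = phi ((\sum_j a j * v 0 j) *: e i).
Proof.
have /fin_all_exists[a aP] j :
    exists lam, forall v x y,
      phi (v + x *: e i + y *: e j) = phi (v + (x + lam * y) *: e i).
  have [<- | ij] := eqVneq i j.
    by exists 1 => v x y; rewrite mul1r scalerDl addrA.
  have [lam lamP] := phi_plane 0 ij.
  by exists lam => v; apply: shear_everywhere.
exists a => v.
suff phi_sum (s : seq 'I_k) u : phi (u + \sum_(j <- s) v 0 j *: e j) =
    phi (u + (\sum_(j <- s) a j * v 0 j) *: e i).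
  by rewrite {1}(row_sum_delta v) -[LHS](congr1 phi (add0r _)) phi_sum add0r.
elim: s u => [|j s IHs] u; first by rewrite !big_nil scale0r.
by rewrite !big_cons addrA IHs addrAC aP addrC [_ + a j * _]addrC addrC.
Qed.

End FactorThroughForm.
End Gluing.

(** * Extending a systematic code *)

Section Codes.
Import GRing.Theory.
Local Open Scope ring_scope.

Lemma MDS_dim_le_length (A : finType) (n k : nat) (C : {set 'rV[A]_n}) :
  (1 < #|A|)%N -> MDS_code k C -> (k <= n)%N.
Proof.
move=> A_gt1 [card_C _]; rewrite -(leq_exp2l _ _ A_gt1) -card_C.
by rewrite (leq_trans (max_card _)) // card_mx mul1n.
Qed.

Lemma imset_injective (aT rT : finType) (f : aT -> rT) (A : {set aT}) :
  (#|A| <= #|f @: A|)%N -> {in A &, injective f}.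
Proof. by move=> leA; apply/imset_injP; rewrite eqn_leq leq_imset_card. Qed.

(** The positions at which v vanishes, the complement of its support. *)
Definition zeros (F : finFieldType) n (v : 'rV[F]_n) : {set 'I_n} :=
  [set s | v 0 s == 0].

Lemma zerosB (F : finFieldType) n (v w : 'rV[F]_n) : zeros (v - w) = agreement v w.
Proof. by apply/setP=> s; rewrite !inE !mxE subr_eq0. Qed.

(** A linear MDS code has a generator matrix E whose columns g j form an identity
block; the first k columns will do. *)
Lemma MDS_systematic (F : finFieldType) (n k : nat) (C : {set 'rV[F]_n}) :
  MDS_code k C -> linear_code k C ->
  exists (E : 'M[F]_(k, n)) (g : 'I_k -> 'I_n),
    [/\ injective g, forall x : 'rV_k, colsub g (x *m E) = x &
        C = [set x *m E | x : 'rV[F]_k]].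
Proof.
move=> C_MDS [U [dimU CE]]; have [card_C C_agree] := C_MDS.
have le_kn := MDS_dim_le_length (finNzRing_gt1 F) C_MDS.
pose g := widen_ord le_kn.
have inj_g : injective g by move=> i j /(congr1 val) /= /val_inj.
have inj_C : {in C &, injective (colsub g : 'rV[F]_n -> 'rV_k)}.
  move=> x y xC yC eq_xy; apply/eqP; apply: contraT => /(C_agree x y xC yC).
  rewrite ltnNge => /negP[]; rewrite -[leqLHS]card_ord -(card_imset _ inj_g).
  rewrite subset_leq_card //; apply/subsetP => _ /imsetP[i _ ->].
  by rewrite inE; have /rowP/(_ i) := eq_xy; rewrite !mxE => ->.
have onto (v : 'rV[F]_k) : exists2 x, x \in C & colsub g x = v.
  have : v \in [set colsub g x | x in C].
    rewrite (_ : [set _ | _ in _] = setT) ?inE //; apply/eqP.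
    by rewrite eqEcard subsetT card_in_imset // card_C cardsT card_mx mul1n leqnn.
  by case/imsetP=> x xC ->; exists x.
have /fin_all_exists2[c cC cg] (i : 'I_k) := onto (delta_mx 0 i).
have xU (x : 'rV_k) : x *m (\matrix_i c i) \in C.
  rewrite CE inE mulmx_sum_row memv_suml // => i _; rewrite memvZ // rowK.
  by have := cC i; rewrite CE inE.
have gK (x : 'rV_k) : colsub g (x *m \matrix_i c i) = x.
  rewrite [RHS]row_sum_delta mulmx_sum_row; apply/rowP=> l.
  rewrite !mxE !summxE; apply: eq_bigr => i _; rewrite rowK [LHS]mxE [RHS]mxE.
  by have /rowP/(_ l) := cg i; rewrite !mxE => ->.
exists (\matrix_i c i), g; split=> //.
apply/esym/eqP; rewrite eqEcard; apply/andP; split.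
  by apply/subsetP=> _ /imsetP[x _ ->].
rewrite card_imset; last exact: can_inj gK.
by rewrite card_C card_mx mul1n leqnn.
Qed.

Lemma linear_code_image (F : finFieldType) (n k : nat) (E : 'M[F]_(k, n)) :
  injective (fun x : 'rV_k => x *m E) ->
  linear_code k [set x *m E | x : 'rV[F]_k].
Proof.
move=> inj_E; exists (limg (linfun (mulmxr E))); split.
  rewrite limg_dim_eq ?dimvf /dim /= ?mul1n //.
  rewrite capfv; apply/eqP/lker0P => x y; rewrite !lfunE /=.
  exact: inj_E.
apply/setP=> v; rewrite inE; apply/imsetP/memv_imgP => [[x _ ->] | [x _ ->]].
  by exists x; rewrite ?memvf // lfunE.
by exists x; rewrite // lfunE.
Qed.

(** An extension by one position: f enumerates the positions kept, j0 is the new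
one, and f' is the partial inverse of f. *)
Lemma extends_deleted (A : finType) (n : nat) (C' : {set 'rV[A]_n.+1})
    (C : {set 'rV[A]_n}) :
  extends C' C ->
  exists (f : 'I_n -> 'I_n.+1) (j0 : 'I_n.+1) (f' : 'I_n.+1 -> option 'I_n),
    [/\ [set colsub f x | x in C'] = C, injective f,
        forall j, if f' j is Some i then j = f i else j = j0 &
        forall i, f i != j0].
Proof.
case=> _ [f [f_mono fE]].
have inj_f : injective f.
  move=> i j eq_ij; apply/val_inj; case: (ltngtP i j) => // /f_mono;
  by rewrite eq_ij ltnn.
have card_im : #|~: (f @: setT)| = 1%N.
  by rewrite cardsCs setCK card_imset // cardsT !card_ord subSnn.
have /cards1P[j0 j0E] : #|~: (f @: setT)| == 1%N by rewrite card_im.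
exists f, j0, (fun j => [pick i | f i == j]); split=> // [j | i].
  case: pickP => [i /eqP // | noi]; apply/set1P; rewrite -j0E inE.
  by apply/imsetP=> -[i _ ji]; have := noi i; rewrite ji eqxx.
have : f i \notin ~: (f @: setT) by rewrite inE negbK imset_f.
by rewrite j0E inE.
Qed.

(** The data of an extension C' of the code generated by E: phi x is the symbol
that C' adds to the word x *m E. *)
Section ExtensionColumn.

Variables (F : finFieldType) (p h n k : nat).
Variables (E : 'M[F]_(k, n)) (g : 'I_k -> 'I_n) (phi : 'rV[F]_k -> F).
Local Notation q := #|F|.
Local Notation e i := (delta_mx (0 : 'I_1) i).
Hypothesis p_prime : prime p.
Hypothesis card_F : q = (p ^ h)%N.
Hypothesis inj_g : injective g.
Hypothesis gK : forall x : 'rV_k, colsub g (x *m E) = x.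
Hypothesis zerosE : forall x : 'rV_k, x != 0 -> (#|zeros (x *m E)| < k)%N.
Hypothesis phi_zeros : forall x y : 'rV_k, x != y -> phi x = phi y ->
  (#|zeros ((x - y) *m E)|.+1 < k)%N.

Lemma info_coord (x : 'rV_k) i : (x *m E) 0 (g i) = x 0 i.
Proof. by have /rowP/(_ i) := gK x; rewrite mxE. Qed.

Lemma zeros_info (x : 'rV_k) (B : {set 'I_k}) :
  {in B, forall i, x 0 i = 0} -> g @: B \subset zeros (x *m E).
Proof.
by move=> xB; apply/subsetP=> _ /imsetP[i iB ->]; rewrite inE info_coord xB.
Qed.

(** A multiple of the row i of E has at least k - 1 zeros. *)
Lemma phi_inj i v : injective (fun x => phi (v + x *: e i)).
Proof.
move=> x y eq_phi; apply/eqP; apply: contraT => ne_xy.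
set d := (v + x *: e i) - (v + y *: e i).
have dE : d = (x - y) *: e i by rewrite /d opprD addrACA subrr add0r scalerBl.
have ne_v : v + x *: e i != v + y *: e i.
  rewrite -subr_eq0 -/d dE; apply/eqP=> /rowP/(_ i).
  by rewrite !mxE !eqxx mulr1 => /eqP; rewrite subr_eq0 (negPf ne_xy).
have : (#|zeros (d *m E)|.+1 < k)%N := phi_zeros ne_v eq_phi.
have : g @: [set~ i] \subset zeros (d *m E).
  apply: zeros_info => j; rewrite !inE dE !mxE => /negPf ->.
  by rewrite andbF mulr0.
move/subset_leq_card; rewrite card_imset // cardsC1 card_ord => le_k.
have k_gt0 : (0 < k)%N by case: (i) => m /(leq_ltn_trans (leq0n m)).
move=> lt_k; have := leq_ltn_trans (le_k : k.-1.+1 <= _.+1)%N lt_k.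
by rewrite prednK ?ltnn.
Qed.

Hypothesis n_large : (2 * (q - (n.+1 - k)) <= q)%N.
Hypothesis n_larger :
  forall t, (0 < t < h -> t %| h -> q - (n.+1 - k) < p ^ (h - t))%N.

Lemma phi_plane i j v : i != j ->
  exists lam, forall x y,
    phi (v + x *: e i + y *: e j) = phi (v + (x + lam * y) *: e i).
Proof.
move=> ij; pose d m := m *: e i + e j : 'rV[F]_k.
have k_gt1 : (1 < k)%N.
  have := subset_leq_card (subsetT [set i; j]).
  by rewrite cards2 ij cardsT card_ord.
have card_ij : #|~: [set i; j]| = k.-2.
  by rewrite cardsCs setCK cards2 ij card_ord subn2.
have d_info m : g @: (~: [set i; j]) \subset zeros (d m *m E).
  apply: zeros_info => l; rewrite !inE negb_or => /andP[/negPf li /negPf lj].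
  by rewrite !mxE li lj !andbF mulr0 addr0.
have nz_d m : d m != 0.
  apply/eqP=> /rowP/(_ j); rewrite !mxE !eqxx [j == i]eq_sym (negPf ij) /=.
  by move/eqP; rewrite mulr0 add0r oner_eq0.
have dE m s : (d m *m E) 0 s = m * E i s + E j s.
  by rewrite mulmxDl -scalemxAl -!rowE !mxE.
have Ei_info l : l != i -> E i (g l) = 0.
  move=> /negPf li; have := info_coord (e i) l.
  by rewrite -rowE !mxE li andbF.
(* For s in A0, the direction e j + slope s *: e i adds the zero s to the k - 2
zeros that every direction of the plane has, so that phi is injective along it. *)
pose A0 := [set s | E i s != 0]; pose slope s := - (E j s / E i s).
have A0_info s : s \in A0 -> s \notin g @: (~: [set i; j]).
  rewrite inE => nz; apply/imsetP=> -[l]; rewrite !inE negb_or => /andP[li _] sE.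
  by rewrite sE Ei_info ?eqxx in nz.
have slope_zero s : s \in A0 -> s \in zeros (d (slope s) *m E).
  by rewrite !inE dE /slope mulNr => nz; rewrite divfK // addNr.
have inj_slope : {in A0 &, injective slope}.
  move=> s s' sA s'A eq_m; apply/eqP; apply: contraT => ne_s.
  have := zerosE (nz_d (slope s)); rewrite ltnNge => /negP[].
  have card_k : #|s |: (s' |: g @: (~: [set i; j]))| = k.
    rewrite cardsU1 !inE negb_or ne_s A0_info // cardsU1 A0_info //.
    by rewrite card_imset // card_ij; move: k_gt1; lia.
  rewrite -[leqLHS]card_k subset_leq_card // !subUset !sub1set d_info.
  by rewrite slope_zero // eq_m slope_zero.
have card_A0 : (n.+1 - k <= #|A0|)%N.
  have : (#|zeros (e i *m E)| < k)%N.
    apply: zerosE; apply/eqP=> /rowP/(_ i); rewrite !mxE !eqxx => /eqP.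
    by rewrite oner_eq0.
  rewrite (_ : zeros _ = ~: A0); last first.
    by apply/setP=> s; rewrite !inE -rowE mxE negbK.
  rewrite cardsCs setCK card_ord.
  by move: (#|A0|) => a; lia.
have card_A : #|slope @: A0| = #|A0| by rewrite card_in_imset.
have le_A : (q - #|slope @: A0| <= q - (n.+1 - k))%N by rewrite card_A leq_sub2l.
pose psi x y := phi (v + x *: e i + y *: e j).
have [|||||| lam lamP] := @plane_level_sets_parallel F p h psi (slope @: A0).
- exact: p_prime.
- exact: card_F.
- move=> y x x'; rewrite /psi ![_ + y *: _]addrAC; exact: phi_inj.
- move=> _ x y t /imsetP[s sA ->] nz_t; set m := slope s.
  have diff : (v + (x + m * t) *: e i + (y + t) *: e j) -
      (v + x *: e i + y *: e j) = t *: d m.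
    apply/rowP=> l; rewrite !mxE; ring.
  apply/eqP=> /phi_zeros; rewrite diff -subr_eq0 diff scaler_eq0 negb_or nz_t nz_d.
  move=> /(_ isT); rewrite ltnNge => /negP[].
  have -> : zeros (t *: d m *m E) = zeros (d m *m E).
    by apply/setP=> l; rewrite !inE -scalemxAl mxE mulf_eq0 (negPf nz_t).
  have card_k : #|s |: g @: (~: [set i; j])|.+1 = k.
    rewrite cardsU1 A0_info // card_imset // card_ij; move: k_gt1; lia.
  rewrite -[leqLHS]card_k ltnS subset_leq_card // subUset sub1set d_info.
  by rewrite slope_zero.
- by rewrite (leq_trans _ n_large) // leq_mul2l le_A orbT.
- by move=> t th t_dvd; apply: leq_ltn_trans le_A (n_larger th t_dvd).
exists lam => x y; have := lamP x y; rewrite /psi => ->.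
by rewrite scale0r addr0.
Qed.

(** Up to relabelling its symbols, the new column is a linear form. *)
Lemma extension_column_linear : exists (a : 'I_k -> F) (s : {perm F}),
  forall x : 'rV_k, s (phi x) = \sum_j a j * x 0 j.
Proof.
case: (posnP k) => [k0 | k_gt0].
  exists (fun _ => 0), (tperm (phi 0) 0) => x.
  have -> : x = 0 by apply/rowP=> j; have := ltn_ord j; rewrite {2}k0.
  by rewrite tpermL big1 // => j _; rewrite mul0r.
pose i0 := Ordinal k_gt0.
have [a aP] := factor_through_form phi_inj phi_plane i0.
exists a, (perm (@phi_inj i0 0))^-1%g => x.
by apply: (canLR (permK _)); rewrite permE add0r.
Qed.

End ExtensionColumn.

End Codes.

(** * Linearity up to equivalence *)

Section Extension.
Import GRing.Theory Num.Theory.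
Local Open Scope ring_scope.

(** The bound on the length in natural numbers: q - (n + 1 - k) bounds the number
of slopes of a plane section of a level set of the new column. *)
Lemma beta_bounds (p h n k : nat) :
  prime p -> (0 < h)%N -> (k <= n)%N -> (beta p h k < n%:R) ->
  (2 * (p ^ h - (n.+1 - k)) <= p ^ h)%N /\
  (forall t, 0 < t < h -> t %| h -> p ^ h - (n.+1 - k) < p ^ (h - t))%N.
Proof.
move=> pr_p h_gt0 le_kn; have p_gt1 := prime_gt1 pr_p; rewrite /beta /=.
have [-> | h_neq1] := eqVneq h 1%N => lt_n.
  split=> [|t]; last by case: t => [|[|t]].
  have : ((p ^ 1 + (k + k))%N%:R < (n + n + 3)%N%:R :> rat).
    by rewrite !natrD; move: lt_n; lra.
  by rewrite ltr_nat; move: (p ^ 1)%N le_kn => q; lia.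
set d := largest_proper_divisor h in lt_n.
have lt_q : (p ^ h + k < n + 1 + p ^ (h - d))%N.
  by rewrite -(ltr_nat rat) !natrD; move: lt_n; lra.
have d_max t : (t < h -> t %| h -> t <= d)%N.
  move=> lt_th t_dvd; rewrite /d /largest_proper_divisor.
  exact: (@leq_bigmax_cond _ (fun i : 'I_h => i %| h)%N (fun i => i)
    (Ordinal lt_th)).
have d_gt0 : (0 < d)%N.
  by apply: d_max; rewrite ?dvd1n //; move: h_gt0 h_neq1; lia.
have le_dh : (d <= h)%N.
  by apply/bigmax_leqP=> i _; apply: ltnW.
have lt_sub : (p ^ h - (n.+1 - k) < p ^ (h - d))%N.
  have : (0 < p ^ (h - d))%N by rewrite expn_gt0 ltnW.
  by move: (p ^ h)%N (p ^ (h - d))%N lt_q le_kn; lia.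
split=> [|t /andP[t_gt0 lt_th] t_dvd].
  have : (2 * p ^ (h - d) <= p ^ h)%N.
    rewrite -[in leqRHS](subnKC le_dh) expnD leq_mul2r; apply/orP; right.
    by rewrite (leq_trans p_gt1) // -[leqLHS]expn1 leq_exp2l.
  by move: lt_sub; lia.
apply: leq_trans lt_sub _; rewrite leq_exp2l //.
by rewrite leq_sub2l // d_max.
Qed.

(** A code whose words w x are those of a systematic linear code and one more
symbol, linear up to the relabelling s, is equivalent to a linear code. *)
Lemma LE_code_of_column (F : finFieldType) (n k : nat) (E : 'M[F]_(k, n))
    (g : 'I_k -> 'I_n) (C' : {set 'rV[F]_n.+1}) (f : 'I_n -> 'I_n.+1)
    (j0 : 'I_n.+1) (f' : 'I_n.+1 -> option 'I_n) (w : 'rV[F]_k -> 'rV[F]_n.+1)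
    (a : 'I_k -> F) (s : {perm F}) :
  (forall x : 'rV_k, colsub g (x *m E) = x) ->
  (forall j, if f' j is Some i then j = f i else j = j0) ->
  (forall i, f i != j0) -> C' = [set w x | x : 'rV_k] ->
  (forall x, colsub f (w x) = x *m E) ->
  (forall x : 'rV_k, s (w x 0 j0) = \sum_j a j * x 0 j) ->
  LE_code C'.
Proof.
move=> gK f'P f_j0 -> wE s_form.
pose E' : 'M_(k, n.+1) := \matrix_(i, j) if f' j is Some l then E i l else a i.
have relabelE x : relabel j0 s (w x) = x *m E'.
  apply/rowP=> j; rewrite !mxE; under eq_bigr do rewrite mxE.
  have := f'P j; case: (f' j) => [l -> | ->].
    rewrite (negPf (f_j0 l)).
    by have /rowP/(_ l) := wE x; rewrite !mxE.
  by rewrite eqxx s_form; apply: eq_bigr => i _; rewrite mulrC.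
have E'_inj : injective (fun x : 'rV_k => x *m E').
  move=> x y; rewrite -!relabelE => eq_xy; rewrite -(gK x) -(gK y) -!wE.
  congr (colsub g _); apply/rowP=> l; have /rowP/(_ (f l)) := eq_xy.
  by rewrite !mxE (negPf (f_j0 l)).
exists k, [set x *m E' | x : 'rV[F]_k]; split; first exact: linear_code_image.
apply: Relation_Operators.rt_step.
have -> : [set x *m E' | x : 'rV[F]_k] =
    [set relabel j0 s v | v in [set w x | x : 'rV[F]_k]].
  by rewrite -imset_comp; apply: eq_imset => x /=; rewrite relabelE.
exact: step_alphabet.
Qed.

Lemma MDS_extension_LE (F : finFieldType) (p h n k : nat)
    (C : {set 'rV[F]_n}) (C' : {set 'rV[F]_n.+1}) :
  prime p -> #|F| = (p ^ h)%N ->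
  (2 * (#|F| - (n.+1 - k)) <= #|F|)%N ->
  (forall t, 0 < t < h -> t %| h -> #|F| - (n.+1 - k) < p ^ (h - t))%N ->
  MDS_code k C -> linear_code k C -> MDS_code k C' -> extends C' C ->
  LE_code C'.
Proof.
move=> pr_p card_F n_large n_larger C_MDS C_lin C'_MDS C'_ext.
have [E [g [inj_g gK CE]]] := MDS_systematic C_MDS C_lin.
have [f [j0 [f' [C'C inj_f f'P f_j0]]]] := extends_deleted C'_ext.
have [[card_C C_agree] [card_C' C'_agree]] := (C_MDS, C'_MDS).
have inj_C' : {in C' &, injective (colsub f : 'rV[F]_n.+1 -> 'rV_n)}.
  by apply: imset_injective; rewrite C'C card_C card_C'.
have word (x : 'rV[F]_k) : exists2 v, v \in C' & colsub f v = x *m E.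
  have : x *m E \in [set colsub f v | v in C'].
    by rewrite C'C CE; apply/imsetP; exists x.
  by case/imsetP=> v vC' ->; exists v.
have /fin_all_exists2[w wC' wE] := word.
have C'E : C' = [set w x | x : 'rV[F]_k].
  apply/setP=> v; apply/idP/imsetP => [vC' | [x _ ->] //].
  have : colsub f v \in C by rewrite -C'C imset_f.
  by rewrite CE => /imsetP[x _ vE]; exists x => //; apply: inj_C'; rewrite ?wE.
have inC (x : 'rV_k) : x *m E \in C by rewrite CE; apply/imsetP; exists x.
have zerosE (x : 'rV_k) : x != 0 -> (#|zeros (x *m E)| < k)%N.
  move=> nz_x; rewrite -[x *m E]subr0 -(mul0mx _ E) zerosB C_agree //.
  by apply: contra_neq nz_x => eq_xE; rewrite -(gK x) eq_xE gK.
(* Words with the same new symbol agree at that position as well. *)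
have phi_zeros (x y : 'rV_k) : x != y -> w x 0 j0 = w y 0 j0 ->
    (#|zeros ((x - y) *m E)|.+1 < k)%N.
  move=> ne_xy eq_phi; have ne_w : w x != w y.
    by apply: contra_neq ne_xy => eq_w; rewrite -(gK x) -(gK y) -!wE eq_w.
  apply: leq_ltn_trans (C'_agree _ _ (wC' x) (wC' y) ne_w).
  rewrite -(card_imset _ inj_f).
  have := cardsU1 j0 (f @: zeros ((x - y) *m E)).
  have -> : j0 \notin f @: zeros ((x - y) *m E).
    by apply/imsetP=> -[l _ j0E]; have := f_j0 l; rewrite -j0E eqxx.
  rewrite add1n => <-; apply/subset_leq_card/subsetP => j /setU1P[-> | ].
    by rewrite inE eq_phi.
  case/imsetP=> l; rewrite mulmxBl zerosB => l_agree ->; move: l_agree.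
  by rewrite !inE -!wE !mxE.
have [a [s s_form]] := extension_column_linear pr_p card_F inj_g gK zerosE
  phi_zeros n_large n_larger.
exact: (LE_code_of_column gK f'P f_j0 C'E wE s_form).
Qed.

End Extension.

Unset Implicit Arguments.

Theorem corollary6p6 (p h : nat) (F : finFieldType) (n k : nat)
    (C : {set 'rV[F]_n}) (C' : {set 'rV[F]_n.+1})
    (p_prime : prime p) (h_gt0 : 0 < h) (card_F : #|F| = p ^ h)
    (C_MDS : MDS_code k C) (C_linear : linear_code k C)
    (n_gt_beta : (beta p h k < n%:R)%R)
    (C'_MDS : MDS_code k C') (C'_extends : extends C' C) :
  LE_code C'.
Proof.
have le_kn := MDS_dim_le_length (finNzRing_gt1 F) C_MDS.
have [n_large n_larger] := beta_bounds p_prime h_gt0 le_kn n_gt_beta.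
apply: (MDS_extension_LE p_prime card_F _ _ C_MDS C_linear C'_MDS C'_extends).
  by rewrite card_F.
by move=> t th t_dvd; rewrite card_F n_larger.
Qed.
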